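(* Let $\nu>2$, let $\mathbf X_1,\mathbf X_2$ be i.i.d. with law $Q$, and suppose that $\mathbb E[\kappa(\mathbf X_1,\mathbf X_1)]<\infty$. Let $\{\lambda_k\}_{k\ge1},\{\phi_k\}_{k\ge1}$ be a weak Mercer representation of $\kappa$ under $Q$, and suppose that for some $\nu^*>\nu$, $\|\kappa(\mathbf X_1,\mathbf X_2)\|_{L_{\nu^*}}<\infty$ and $\sup_{K\ge1}\|\sum_{k=1}^K\lambda_k\phi_k(\mathbf X_1)\phi_k(\mathbf X_2)\|_{L_{\nu^*}}<\infty$. Suppose further that (i) $\big\|\,\|\nabla\log p(\mathbf X_1)\|_2\big\|_{L_{2\nu^{**}}}<\infty$ for $\nu^{**}=\frac{\nu(\nu+\nu^* )}{\nu^*-\nu}$; (ii) $\sup_{k\in\mathbb N}\|\phi_k(\mathbf X_1)\|_{L_{2\nu}}<\infty$; (iii) the $\phi_k$ are differentiable with $\sup_{k\in\mathbb N}\big\|\,\|\nabla\phi_k(\mathbf X_1)\|_2\big\|_{L_\nu}<\infty$; (iv) as $K\to\infty$, $\Big\|\,\big\|\sum_{k=1}^K\lambda_k(\nabla\phi_k(\mathbf X_1))\phi_k(\mathbf X_2)-\nabla_1\kappa(\mathbf X_1,\mathbf X_2)\big\|_2\Big\|_{L_{2\nu}}\to0$ and $\Big\|\sum_{k=1}^K\lambda_k(\nabla\phi_k(\mathbf X_1))^\top(\nabla\phi_k(\mathbf X_2))-\mathrm{Tr}(\nabla_1\nabla_2\kappa(\mathbf X_1,\mathbf X_2))\Big\|_{L_\nu}\to0$.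 For $1\le l\le d$ and $k'\in\mathbb N$ define $$\alpha_{(k'-1)d+l}=\lambda_{k'},\qquad \psi_{(k'-1)d+l}(\mathbf x)=(\partial_{x_l}\log p(\mathbf x))\,\phi_{k'}(\mathbf x)+\partial_{x_l}\phi_{k'}(\mathbf x).$$ Then, with $\nu'=\min\{\nu,3\}$, $$\Big\|\sum_{k=1}^K\alpha_k\psi_k(\mathbf X_1)\psi_k(\mathbf X_2)-u_P^{\mathrm{KSD}}(\mathbf X_1,\mathbf X_2)\Big\|_{L_{\nu'}}\to0\quad\text{as }K\to\infty.$$
   Context: $P,Q$ are probability measures on $\mathbb R^d$; $P$ has a continuously differentiable, positive Lebesgue density $p$. $\kappa$ is a measurable kernel on $\mathbb R^d$ (i.e. $\kappa(\mathbf x,\mathbf x')=\langle\phi(\mathbf x),\phi(\mathbf x')\rangle_{\mathcal H}$ for some Hilbert space $\mathcal H$ and map $\phi:\mathbb R^d\to\mathcal H$), continuously differentiable with respect to both arguments; $\nabla_1,\nabla_2$ denote the differential operators in the first and second argument of $\kappa$. Define $$u_P^{\mathrm{KSD}}(\mathbf x,\mathbf x')=(\nabla\log p(\mathbf x))^\top(\nabla\log p(\mathbf x'))\kappa(\mathbf x,\mathbf x')+(\nabla\log p(\mathbf x))^\top\nabla_2\kappa(\mathbf x,\mathbf x')+(\nabla\log p(\mathbf x'))^\top\nabla_1\kappa(\mathbf x,\mathbf x')+\mathrm{Tr}(\nabla_1\nabla_2\kappa(\mathbf x,\mathbf x')),$$ and it is assumed that $\mathbb E_{\mathbf X\sim Q}[u_P^{\mathrm{KSD}}(\mathbf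 X,\mathbf X)]<\infty$. $\|\cdot\|_2$ is the Euclidean norm and $\|Y\|_{L_\nu}=\mathbb E[|Y|^\nu]^{1/\nu}$. A weak Mercer representation of $\kappa$ under $Q$ is a sequence of functions $\{\phi_k\}_{k\ge1}$ in $L_2(\mathbb R^d,Q)$ and a sequence of non-negative values $\{\lambda_k\}_{k\ge1}$ with $\lambda_k\to0$ such that $\big|\sum_{k=1}^K\lambda_k\phi_k(\mathbf X_1)\phi_k(\mathbf X_2)-\kappa(\mathbf X_1,\mathbf X_2)\big|\to0$ almost surely as $K\to\infty$. *)

(* Defs.v *)
From HB Require Import structures.
From mathcomp Require Import all_boot all_order all_algebra.
From mathcomp Require Import sesquilinear.
From mathcomp Require Import all_classical all_reals all_analysis.
From mathcomp Require Import measurable_realfun.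

Set Implicit Arguments.
Unset Strict Implicit.
Unset Printing Implicit Defensive.

Import Order.TTheory GRing.Theory Num.Theory.
Import numFieldNormedType.Exports.

Local Open Scope classical_set_scope.
Local Open Scope ring_scope.

(** The Borel sigma-algebra on R^d = 'rV[R]_d; the topology of 'rV[R]_d is the
    one of the sup norm, i.e. the Euclidean topology. *)
Section borel_rV.
Context (R : realType) (d : nat).

Let borel0 : <<s @open 'rV[R]_d >> set0.
Proof. exact: sigma_algebra0. Qed.

Let borelC (A : set 'rV[R]_d) : <<s open >> A -> <<s open >> (~` A).
Proof. exact: sigma_algebraC. Qed.

Let borel_bigcup (F : (set 'rV[R]_d)^nat) :
  (forall i, <<s open >> (F i)) -> <<s open >> (\bigcup_i F i).
Proof. exact: sigma_algebra_bigcup. Qed.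

HB.instance Definition _ := @isMeasurable.Build
  (sigma_display (@open 'rV[R]_d)) 'rV[R]_d <<s open >>
  borel0 borelC borel_bigcup.

End borel_rV.

(** Lebesgue measure on R^d, as the d-fold product of Lebesgue measure on R
    transported along R x R^n -> R^(n+1), (t, v) |-> (t, v_1, ..., v_n);
    R^0 is a single point of mass 1. By the lemma below it gives boxes their
    volume. *)
Fixpoint lebesgue_rV (R : realType) (d : nat) : set 'rV[R]_d -> \bar R :=
  match d with
  | 0 => \d_(0 : 'rV[R]_0)
  | n.+1 => pushforward (@lebesgue_measure R \x @lebesgue_rV R n)%E
              (fun z : R * 'rV[R]_n => row_mx z.1%:M z.2 : 'rV[R]_(1 + n))
  end.

Lemma lebesgue_rV_box (R : realType) (d : nat) (a b : 'I_d -> R) :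
  (forall i, a i <= b i) ->
  lebesgue_rV [set v : 'rV[R]_d | forall i, a i <= v 0 i <= b i]
  = (\prod_(i < d) (b i - a i))%:E.
Proof.
elim: d a b => [|d IH] a b ab.
  by rewrite /= big_ord0 diracE mem_set// => -[].
rewrite [LHS]/= /pushforward /product_measure1 big_ord_recl/=.
pose c : \bar R := (\prod_(i < d) (b (lift ord0 i) - a (lift ord0 i)))%:E.
transitivity (\int[@lebesgue_measure R]_x
    ((\1_(`[a ord0, b ord0]%classic : set R) x)%:E * c))%E; last first.
  have c0 : (0 <= c)%E by rewrite lee_fin prodr_ge0// => i _; rewrite subr_ge0.
  rewrite ge0_integralZr//; last first.
    by apply/measurable_EFinP/measurable_indic; exact: measurable_itv.
  rewrite integral_indic// setIT.
  rewrite [X in (X * _)%E](_ : _ = (b ord0 - a ord0)%:E) ?EFinM//.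
  transitivity (lebesgue_measure (`[a ord0, b ord0]%classic : set R)).
    by [].
  rewrite lebesgue_measure_itv/= lte_fin; case: ltP => [//|ba].
  by have -> : b ord0 = a ord0; [apply/le_anti; rewrite ab ba|rewrite subrr].
apply: eq_integral => x _ /=; rewrite indicE.
have H0 (v : 'rV[R]_d) : (row_mx x%:M v : 'rV[R]_(1 + d)) 0 ord0 = x.
  have -> : ord0 = lshift d (ord0 : 'I_1) by exact: val_inj.
  by rewrite row_mxEl mxE eqxx mulr1n.
have H1 (v : 'rV[R]_d) i :
    (row_mx x%:M v : 'rV[R]_(1 + d)) 0 (lift ord0 i) = v 0 i.
  have -> : lift ord0 i = rshift 1 i by exact: val_inj.
  by rewrite row_mxEr.
have [xI|xI] := boolP (x \in _).
  rewrite mul1e /c -(IH (fun i => a (lift ord0 i)) (fun i => b (lift ord0 i)))//.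
  congr lebesgue_rV; apply/seteqP; split => v; rewrite /xsection /= inE /= => h i.
    by have := h (lift ord0 i); rewrite H1.
  case: (unliftP ord0 i) => [j|] ->; first by rewrite H1.
  by rewrite H0; move: xI; rewrite inE/= in_itv.
rewrite mul0e [X in lebesgue_rV X](_ : _ = set0); last first.
  rewrite -subset0 => v; rewrite /xsection /= inE /= => /(_ ord0).
  by rewrite H0 => h; move: xI; rewrite notin_setE/= in_itv/= h.
have leb0 (n : nat) : lebesgue_rV (set0 : set 'rV[R]_n) = 0%E.
  elim: n => [|n IHn]; first by rewrite /= measure0.
  rewrite [LHS]/= /pushforward /product_measure1 integral0_eq// => y _ /=.
  by rewrite preimage_set0 xsection0.
exact: leb0.
Qed.

Section defs.
Context {R : realType}.

Section vectors.
Context {d : nat}.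
Implicit Types (u v x y : 'rV[R]_d) (f p : 'rV[R]_d -> R).
Implicit Types (kappa : 'rV[R]_d -> 'rV[R]_d -> R).

Definition dotrv u v : R := \sum_(l < d) u 0 l * v 0 l.

(** The norm [`|v|] of the library is the sup norm. *)
Definition norm2 v : R := Num.sqrt (dotrv v v).

Definition partial (l : 'I_d) f x : R := 'D_(delta_mx 0 l) f x.

Definition grad f x : 'rV[R]_d := \row_l partial l f x.

Definition continuously_differentiable f :=
  (forall x, differentiable f x) /\ continuous (grad f).

Definition grad1 kappa x x' : 'rV[R]_d := grad (fun y => kappa y x') x.

Definition grad2 kappa x x' : 'rV[R]_d := grad (kappa x) x'.

(** The matrix with entries d^2 kappa / (dx_i dx'_j). *)
Definition grad12 kappa x x' : 'M[R]_d :=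
  \matrix_(i, j) partial i (fun y => grad2 kappa y x' 0 j) x.

(** kappa is of class C^(1,1): the partial derivatives of order at most one in
    each argument exist and are jointly continuous. *)
Definition kernel_C1 kappa :=
  [/\ forall x x', differentiable (fun y => kappa y x') x,
      forall x x', differentiable (kappa x) x',
      forall x x', differentiable (fun y => grad2 kappa y x') x
    & [/\ continuous (fun z : 'rV[R]_d * 'rV[R]_d => grad1 kappa z.1 z.2),
          continuous (fun z : 'rV[R]_d * 'rV[R]_d => grad2 kappa z.1 z.2)
        & continuous (fun z : 'rV[R]_d * 'rV[R]_d => grad12 kappa z.1 z.2)]].

(** A real Hilbert space is a complete normed space whose norm comes from an
    inner product. *)
Definition measurable_psd_kernel kappa :=
  measurable_fun [set: 'rV[R]_d * 'rV[R]_d] (fun z => kappa z.1 z.2) /\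
  exists (H : completeNormedModType R) (ip : {dot H for idfun})
         (feat : 'rV[R]_d -> H),
    (forall h, ip h h = `|h| ^+ 2) /\
    (forall x x', kappa x x' = ip (feat x) (feat x')).

Definition has_lebesgue_density (P : probability 'rV[R]_d R) p :=
  forall A, measurable A ->
    P A = (\int[@lebesgue_rV R d]_(x in A) (p x)%:E)%E.

Definition score p x : 'rV[R]_d := grad (fun y => ln (p y)) x.

Definition u_KSD p kappa x x' : R :=
  dotrv (score p x) (score p x') * kappa x x'
  + dotrv (score p x) (grad2 kappa x x')
  + dotrv (score p x') (grad1 kappa x x')
  + \tr (grad12 kappa x x').

End vectors.

Section random.
Context {dO dT : measure_display} {Omega : measurableType dO}
  {T : measurableType dT} {Pr : probability Omega R}.

Definition iid_pair (X1 X2 : {RV Pr >-> T}) (Q : probability T R) :=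
  [/\ forall A, measurable A -> distribution Pr X1 A = Q A,
      forall A, measurable A -> distribution Pr X2 A = Q A
    & forall A B, measurable A -> measurable B ->
        Pr (X1 @^-1` A `&` X2 @^-1` B)
        = (Pr (X1 @^-1` A) * Pr (X2 @^-1` B))%E].

(** X1 and X2 are meant to be independent with law Q. *)
Definition weak_mercer (X1 X2 : {RV Pr >-> T}) (Q : probability T R)
    (kappa : T -> T -> R) (lam : nat -> R) (phi : nat -> T -> R) :=
  [/\ forall k, phi k \in Lfun Q 2%:E,
      forall k, 0 <= lam k,
      lam @ \oo --> 0
    & {ae Pr, forall w,
        `|\sum_(k < K) lam k * phi k (X1 w) * phi k (X2 w)
          - kappa (X1 w) (X2 w)| @[K --> \oo] --> 0}].

End random.

End defs.

(* Main.v *)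
Require Import Defs.
From HB Require Import structures.
From mathcomp Require Import all_boot all_order all_algebra.
From mathcomp Require Import sesquilinear.
From mathcomp Require Import all_classical all_reals all_analysis.
From mathcomp Require Import measurable_realfun ring lra.

Set Implicit Arguments.
Unset Strict Implicit.
Unset Printing Implicit Defensive.

Import Order.TTheory GRing.Theory Num.Theory.
Import numFieldNormedType.Exports.

Local Open Scope classical_set_scope.
Local Open Scope ring_scope.

(** Group the K terms into blocks of d: writing K = q d + r with r < d, the q
    complete blocks sum to

      sum_(k < q) lam_k <(S phi_k)(X1), (S phi_k)(X2)>,

    where (S f)(x) = f(x) score(x) + grad f(x) is the Langevin Stein operator
    (stein), whose coordinates at phi_k are the functions psi_(k d + l). Now
    u_KSD is what one gets by applying S formally to kappa in both arguments.
    Expanding the inner product therefore splits the error of the complete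
    blocks into four terms (stein_sum_err):

      <s1, s2> D + <s1, G'> + <s2, G> + T,

    with s1, s2 the score at X1, X2, and D, G, T the errors of the Mercer sums
    for kappa, for its gradient in the first argument and for the trace of its
    mixed derivatives. G' is G with X1 and X2 exchanged, because kappa, being an
    inner product of features, is symmetric.

    T tends to 0 in L_nu by hypothesis. G tends to 0 in L_(2 nu), and so does G'
    because (X1, X2) and (X2, X1) have the same law (iid_Lnorm_swap); the score
    has a finite moment of order 2 nu, so Hoelder's inequality handles the two
    middle terms (cvg_Lnorm0_dotrv). As for the first term, D tends to 0 almost
    surely and is bounded in L_nus, hence it tends to 0 in L_a for the midpoint
    a of nu and nus (cvg_Lnorm0_bounded). The score has a finite moment of order
    2 m, where m is the exponent that Hoelder's inequality pairs with a to reach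
    L_nu (hoelder_exponents); hence <s1, s2> lies in L_m, and <s1, s2> D tends to
    0 in L_nu (cvg_Lnorm0_dotrvM).

    The r < d remaining terms belong to one block, whose weight lam_q tends to
    0. By independence, the norm in L_nu of psi(X1) psi(X2) is the product of
    the norms of its factors (iid_Lnorm_prod), and these are bounded uniformly
    in the index by the moment hypotheses on phi_k, its gradient and the score
    (Lnorm_stein_dom_le), so that the remainder vanishes in L_nu as well
    (cvg_Lnorm0_remainder). Finally, the L_nu norm dominates the norm of order
    min(nu, 3). *)

(** * Norms in L_p of a probability measure *)

Lemma ge0_cvge0P (R : realType) (u : (\bar R)^nat) :
  (forall n, 0 <= u n)%E ->
  (forall e : R, 0 < e -> \forall n \near \oo, (u n <= e%:E)%E) ->
  u n @[n --> \oo] --> 0%E.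
Proof.
move=> u0 ue.
apply/fine_cvgP; split.
  have := ue _ ltr01; apply: filterS => n un.
  by rewrite fin_numElt (lt_le_trans _ (u0 n))// (le_lt_trans un)// ltry.
apply/cvgrPdist_le => e e0.
have := ue _ e0; apply: filterS => n un /=.
rewrite sub0r normrN ger0_norm ?fine_ge0//.
rewrite -lee_fin fineK// fin_numElt (lt_le_trans _ (u0 n))//.
by rewrite (le_lt_trans un)// ltry.
Qed.

Lemma cvge0_near_le (R : realType) (u : (\bar R)^nat) (e : R) : 0 < e ->
  u n @[n --> \oo] --> 0%E -> \forall n \near \oo, (u n <= e%:E)%E.
Proof.
move=> e0 /fine_cvgP[ufin /cvgrPdist_le /(_ _ e0)].
move=> ue; near=> n.
have un : u n \is a fin_num by near: n.
rewrite -[u n]fineK// lee_fin (le_trans (ler_norm _))//.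
by rewrite -normrN -sub0r; near: n.
Unshelve. all: by end_near. Qed.

Lemma ge0_squeeze_cvge0 (R : realType) (u v : (\bar R)^nat) :
  (forall n, 0 <= u n)%E -> (forall n, u n <= v n)%E ->
  v n @[n --> \oo] --> 0%E -> u n @[n --> \oo] --> 0%E.
Proof.
move=> u0 uv v0; apply: (@squeeze_cvge _ _ _ _ (fun=> 0%E) u v) => //.
  by apply: nearW => n; rewrite u0 uv.
exact: cvg_cst.
Qed.

Lemma cvg_norm_powR0 (R : realType) (u : R^nat) (p : R) : 0 < p ->
  u n @[n --> \oo] --> 0 -> `|u n| `^ p @[n --> \oo] --> 0.
Proof.
move=> p0 u0; apply/cvgrPdist_le => e e0.
have e'0 : 0 < e `^ p^-1 by rewrite powR_gt0.
have /cvgrPdist_le/(_ _ e'0) := u0; apply: filterS => n /=.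
rewrite !sub0r !normrN (ger0_norm (powR_ge0 _ _)) => un.
rewrite -[leRHS](powRr1 (ltW e0)) -(mulVf (lt0r_neq0 p0)) powRrM.
by apply: ge0_ler_powR => //; rewrite ?nnegrE ?powR_ge0// ltW.
Qed.

Section Lnorm_theory.
Context {d} {T : measurableType d} {R : realType} (Pr : probability T R).
Implicit Types (f g h : T -> R) (r p q : R).
Local Notation N r f := (Lnorm Pr r%:E (fun w => (f w)%:E)).

Lemma measurable_norm_powR f r : measurable_fun setT f ->
  measurable_fun setT (fun w => (`|f w| `^ r)%:E).
Proof.
move=> mf; apply/measurable_EFinP.
apply: (measurableT_comp (measurable_powR r)).
exact: measurableT_comp.
Qed.

Lemma LnormE f r : N r f = ((\int[Pr]_w (`|f w| `^ r)%:E) `^ r^-1)%E.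
Proof. by rewrite unlock. Qed.

Lemma le_Lnorm f g r : 0 < r ->
  measurable_fun setT f -> measurable_fun setT g ->
  (forall w, `|f w| <= g w) -> (N r f <= N r g)%E.
Proof.
move=> r0 mf mg fg; rewrite !LnormE.
apply: gt0_ler_poweR; first by rewrite invr_ge0 ltW.
- by rewrite in_itv/= leey ?andbT integral_ge0// => w _;
    rewrite lee_fin powR_ge0.
- by rewrite in_itv/= leey ?andbT integral_ge0// => w _;
    rewrite lee_fin powR_ge0.
apply: ge0_le_integral => //.
- exact: measurable_norm_powR.
- exact: measurable_norm_powR.
- move=> w _; rewrite lee_fin; apply: ge0_ler_powR.
  + exact: ltW.
  + by rewrite nnegrE.
  + by rewrite nnegrE.
  + exact: le_trans (fg w) (ler_norm _).
Qed.

Lemma Lnorm_norm_powR f s r : 0 < s -> 0 < r ->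
  N s (fun w => `|f w| `^ r) = (N (r * s) f `^ r)%E.
Proof.
move=> s0 r0; rewrite !LnormE -poweRrM invfM mulrAC mulVf ?gt_eqF// mul1r.
congr (_ `^ _)%E; apply: eq_integral => w _.
by rewrite ger0_norm ?powR_ge0// -powRrM.
Qed.

(** The conjugate Hoelder inequality, applied to |f|^r and |g|^r with the
    conjugate exponents p/r and q/r. *)
Lemma hoelder_gen f g p q r : 0 < r -> 0 < p -> 0 < q ->
  p^-1 + q^-1 = r^-1 ->
  measurable_fun setT f -> measurable_fun setT g ->
  (N r (fun w => f w * g w)%R <= N p f * N q g)%E.
Proof.
move=> r0 p0 q0 pqr mf mg.
have mfr : measurable_fun setT (fun w => `|f w| `^ r).
  exact/measurable_EFinP/measurable_norm_powR.
have mgr : measurable_fun setT (fun w => `|g w| `^ r).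
  exact/measurable_EFinP/measurable_norm_powR.
have pqr1 : ((r^-1 * p)^-1 + (r^-1 * q)^-1 = 1)%R.
  by rewrite !invfM !invrK -mulrDr pqr mulfV ?gt_eqF.
have rV0 : 0 < r^-1 by rewrite invr_gt0.
have := hoelder Pr mfr mgr (mulr_gt0 rV0 p0) (mulr_gt0 rV0 q0) pqr1.
rewrite !Lnorm_norm_powR ?mulr_gt0// !mulrA !mulfV ?gt_eqF// !mul1r.
have -> : Lnorm Pr 1 (EFin \o (fun w => `|f w| `^ r) \* (fun w => `|g w| `^ r))
    = (N r (fun w => f w * g w) `^ r)%E.
  have := Lnorm_norm_powR (fun w => f w * g w) ltr01 r0.
  rewrite mulr1 => <-.
  by apply: eq_Lnorm => w /=; rewrite normrM powRM.
rewrite -poweRM ?Lnorm_ge0// => H.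
have := gt0_ler_poweR (ltW rV0) _ _ H.
rewrite -!poweRrM mulfV ?gt_eqF// !poweRe1 ?mule_ge0 ?Lnorm_ge0//; apply.
- by rewrite in_itv/= leey ?andbT poweR_ge0.
- by rewrite in_itv/= leey ?andbT poweR_ge0.
Qed.

(** Hoelder's inequality against the constant 1, of norm 1 as the measure has
    mass 1. *)
Lemma le_Lnorm_exponent f r p : 0 < r -> r <= p ->
  measurable_fun setT f -> (N r f <= N p f)%E.
Proof.
move=> r0; rewrite le_eqVlt => /predU1P[->//|rp] mf.
have p0 : 0 < p by exact: lt_trans rp.
pose q := (r^-1 - p^-1)^-1.
have q0 : 0 < q by rewrite invr_gt0 subr_gt0 ltf_pV2.
have := @hoelder_gen f (cst 1) p q r r0 p0 q0.
rewrite /q invrK addrC subrK => /(_ erefl mf (measurable_cst _)).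
have -> : N q (cst 1) = 1%E.
  transitivity (Pr [set: T] `^ q^-1)%E; first exact: Lnorm_cst1.
  by rewrite probability_setT poweR1r.
by rewrite mule1; under eq_Lnorm do rewrite mulr1.
Qed.

Lemma LnormZ_real f (c : R) r : 0 < r -> measurable_fun setT f ->
  N r (fun w => c * f w) = (`|c|%:E * N r f)%E.
Proof.
move=> r0 mf; rewrite !LnormE.
under eq_integral do rewrite normrM powRM// EFinM.
rewrite (ge0_integralZl _ _ (measurable_norm_powR r mf)) ?lee_fin ?powR_ge0//.
rewrite poweRM ?lee_fin ?powR_ge0//; last first.
  by apply: integral_ge0 => w _; rewrite lee_fin powR_ge0.
by rewrite poweR_EFin -powRrM mulfV ?gt_eqF// powRr1.
Qed.

Lemma cvg_Lnorm0_le (f_ g_ : (T -> R)^nat) r : 0 < r ->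
  (forall n, measurable_fun setT (f_ n)) ->
  (forall n, measurable_fun setT (g_ n)) ->
  (forall n w, `|f_ n w| <= g_ n w) ->
  N r (g_ n) @[n --> \oo] --> 0%E -> N r (f_ n) @[n --> \oo] --> 0%E.
Proof.
move=> r0 mf mg fg g0; apply: ge0_squeeze_cvge0 g0 => n; first exact: Lnorm_ge0.
exact: le_Lnorm.
Qed.

Lemma cvg_Lnorm0_exponent (f_ : (T -> R)^nat) r p : 0 < r -> r <= p ->
  (forall n, measurable_fun setT (f_ n)) ->
  N p (f_ n) @[n --> \oo] --> 0%E -> N r (f_ n) @[n --> \oo] --> 0%E.
Proof.
move=> r0 rp mf f0; apply: ge0_squeeze_cvge0 f0 => n; first exact: Lnorm_ge0.
exact: le_Lnorm_exponent.
Qed.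

Lemma cvg_Lnorm0D (f_ g_ : (T -> R)^nat) r : 1 <= r ->
  (forall n, measurable_fun setT (f_ n)) ->
  (forall n, measurable_fun setT (g_ n)) ->
  N r (f_ n) @[n --> \oo] --> 0%E -> N r (g_ n) @[n --> \oo] --> 0%E ->
  N r (fun w => f_ n w + g_ n w) @[n --> \oo] --> 0%E.
Proof.
move=> r1 mf mg f0 g0.
have fg0 : (N r (f_ n) + N r (g_ n))%E @[n --> \oo] --> 0%E.
  by rewrite -[X in _ --> X]adde0; apply: cvgeD.
apply: ge0_squeeze_cvge0 fg0 => n; first exact: Lnorm_ge0.
exact: minkowski.
Qed.

Lemma cvg_Lnorm0M (h : T -> R) (f_ : (T -> R)^nat) p q r :
  0 < r -> 0 < p -> 0 < q -> p^-1 + q^-1 = r^-1 ->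
  measurable_fun setT h -> (forall n, measurable_fun setT (f_ n)) ->
  (N p h < +oo)%E -> N q (f_ n) @[n --> \oo] --> 0%E ->
  N r (fun w => h w * f_ n w) @[n --> \oo] --> 0%E.
Proof.
move=> r0 p0 q0 pqr mh mf hoo f0.
have hf0 : (N p h * N q (f_ n))%E @[n --> \oo] --> 0%E.
  rewrite -[X in _ --> X](mule0 (N p h)).
  by apply: cvgeZl => //; rewrite ge0_fin_numE ?Lnorm_ge0.
apply: ge0_squeeze_cvge0 hf0 => n; first exact: Lnorm_ge0.
exact: hoelder_gen.
Qed.

(** Vitali's theorem in the easy case of a bounded higher norm. Everything
    above the level M has small mass, uniformly in n, because
    |f|^p <= min(|f|, M)^p + M^(p - q) |f|^q; below M dominated convergence
    applies. *)
Lemma cvg_Lnorm0_bounded (f_ : (T -> R)^nat) p q (C : R) : 0 < p -> p < q ->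
  (forall n, measurable_fun setT (f_ n)) ->
  {ae Pr, forall w, f_ n w @[n --> \oo] --> 0} ->
  (forall n, N q (f_ n) <= C%:E)%E ->
  N p (f_ n) @[n --> \oo] --> 0%E.
Proof.
move=> p0 pq mf f0 fC.
have q0 : 0 < q by exact: lt_trans pq.
have C0 : 0 <= C.
  by rewrite -lee_fin (le_trans (Lnorm_ge0 Pr q%:E _) (fC 0%N)).
have fCq n : (\int[Pr]_w (`|f_ n w| `^ q)%:E <= (C `^ q)%:E)%E.
  have := powR_Lnorm Pr (EFin \o f_ n) (lt0r_neq0 q0).
  rewrite /= => <-; rewrite -poweR_EFin; apply: gt0_ler_poweR => //.
  - exact: ltW.
  - by rewrite in_itv/= leey ?andbT Lnorm_ge0.
  - by rewrite in_itv/= leey ?andbT lee_fin.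
  - exact: fC.
have mtrunc (M : R) n :
    measurable_fun setT (fun w => (Num.min `|f_ n w| M `^ p)%:E).
  apply/measurable_EFinP; apply: (measurableT_comp (measurable_powR p)).
  by apply: measurable_minr => //; exact: measurableT_comp.
have trunc0 (M : R) : 0 < M ->
    (\int[Pr]_w (Num.min `|f_ n w| M `^ p)%:E)%E @[n --> \oo] --> 0%E.
  move=> M0.
  have [] := @dominated_convergence _ _ _ Pr setT measurableT
    (fun n w => (Num.min `|f_ n w| M `^ p)%:E) (cst 0%E) (cst (M `^ p)%:E).
  - exact: mtrunc.
  - exact: measurable_cst.
  - apply: filterS f0 => w fw _.
    apply/fine_cvgP; split; first exact: nearW.
    apply: (@squeeze_cvgr _ _ _ _ (fun=> 0) (fun n => `|f_ n w| `^ p)).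
    + apply: nearW => n /=; rewrite powR_ge0/=.
      apply: ge0_ler_powR; rewrite ?nnegrE ?(ltW p0)//.
        by rewrite le_min normr_ge0 ltW.
      by rewrite ge_min lexx.
    + exact: cvg_cst.
    + exact: cvg_norm_powR0.
  - exact: (finite_measure_integrable_cst Pr (M `^ p) measurableT).
  - apply: nearW => w n _; rewrite /= lee_fin ger0_norm ?powR_ge0//.
    apply: ge0_ler_powR; rewrite ?nnegrE ?(ltW p0) ?(ltW M0)//.
      by rewrite le_min normr_ge0 ltW.
    by rewrite ge_min lexx orbT.
  - by move=> _ _; rewrite integral0.
have cut (M t : R) : 0 < M -> 0 <= t ->
    t `^ p <= Num.min t M `^ p + M `^ (p - q) * t `^ q.
  move=> M0 t0; case: (leP t M) => [tM|Mt].
    by rewrite lerDl mulr_ge0// powR_ge0.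
  have tgt0 : 0 < t by exact: lt_trans Mt.
  have -> : t `^ p = t `^ (p - q) * t `^ q.
    by rewrite -powRD ?subrK// (gt_eqF tgt0) implybT.
  apply: (@le_trans _ _ (M `^ (p - q) * t `^ q)); last first.
    by rewrite lerDr powR_ge0.
  rewrite ler_wpM2r ?powR_ge0// -(opprB q p) !powRN lef_pV2 ?posrE ?powR_gt0//.
  by apply: ge0_ler_powR; rewrite ?nnegrE ?subr_ge0 ltW.
apply: ge0_cvge0P => [n|e e0]; first exact: Lnorm_ge0.
have ep0 : 0 < e `^ p by rewrite powR_gt0.
have C1 : 0 < (C + 1) `^ q by rewrite powR_gt0// ltr_wpDl.
(* the level above which the tails of all f_ n have p-th moment at most e^p/2 *)
pose M := (2 * (C + 1) `^ q / e `^ p) `^ (q - p)^-1.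
have M0 : 0 < M by rewrite powR_gt0// divr_gt0// mulr_gt0.
have tail : M `^ (p - q) * C `^ q <= e `^ p / 2.
  rewrite -(opprB q p) powRN -powRrM mulVf ?subr_eq0 ?gt_eqF//.
  rewrite powRr1; last by rewrite ltW// divr_gt0// mulr_gt0.
  rewrite invf_div -mulrA ler_pM2l// ler_pdivrMl ?mulr_gt0//.
  rewrite mulrAC mulfV ?pnatr_eq0// mul1r.
  by apply: ge0_ler_powR; rewrite ?nnegrE ?addr_ge0 ?lerDl// ltW.
have e2 : 0 < e `^ p / 2 by rewrite divr_gt0.
have := cvge0_near_le e2 (trunc0 _ M0); apply: filterS => n trunc.
rewrite LnormE -[leRHS](_ : ((e `^ p)%:E `^ p^-1)%E = _); last first.
  by rewrite poweR_EFin -powRrM mulfV ?gt_eqF// powRr1 ?ltW.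
apply: gt0_ler_poweR.
- by rewrite invr_ge0 ltW.
- by rewrite in_itv/= leey ?andbT integral_ge0// => w _; rewrite lee_fin.
- by rewrite in_itv/= leey ?andbT lee_fin ltW.
apply: (@le_trans _ _ (\int[Pr]_w ((Num.min `|f_ n w| M `^ p)%:E
    + (M `^ (p - q))%:E * (`|f_ n w| `^ q)%:E))%E).
  apply: ge0_le_integral => //.
  - exact: measurable_norm_powR.
  - apply: emeasurable_funD; first exact: mtrunc.
    exact/measurable_funeM/measurable_norm_powR.
  - by move=> w _; rewrite -EFinM -EFinD lee_fin cut.
rewrite ge0_integralD//; last 2 first.
- by move=> w _; rewrite -EFinM lee_fin mulr_ge0// powR_ge0.
- exact/measurable_funeM/measurable_norm_powR.
rewrite (ge0_integralZl _ _ (measurable_norm_powR q (mf n)));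
  rewrite ?lee_fin ?powR_ge0//.
rewrite [leRHS](_ : _ = (e `^ p / 2)%:E + (e `^ p / 2)%:E)%E; last first.
  by rewrite -EFinD -splitr.
apply: leeD => //; apply: le_trans _ (_ : (M `^ (p - q) * C `^ q)%:E <= _)%E.
  by rewrite EFinM lee_wpmul2l ?lee_fin ?powR_ge0.
  by rewrite lee_fin.
by move=> w _; rewrite lee_fin powR_ge0.
Qed.

End Lnorm_theory.

(** * Pairs of independent, identically distributed variables *)

Section iid.
Context {R : realType} {dO dT : measure_display} {Omega : measurableType dO}
  {T : measurableType dT} {Pr : probability Omega R}.
Implicit Types (Q : probability T R) (X : {RV Pr >-> T}).

Lemma iid_pairC X1 X2 Q : iid_pair X1 X2 Q -> iid_pair X2 X1 Q.
Proof.
move=> [X1Q X2Q X12]; split=> // A B mA mB.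
by rewrite setIC X12// muleC.
Qed.

Lemma measurable_pair X1 X2 : measurable_fun setT (fun w => (X1 w, X2 w)).
Proof. exact: measurable_fun_pair. Qed.

Lemma measurable_comp_pair X1 X2 (h : T -> T -> R) :
  measurable_fun setT (fun z : T * T => h z.1 z.2) ->
  measurable_fun setT (fun w => h (X1 w) (X2 w)).
Proof. by move=> mh; exact: measurableT_comp mh (measurable_pair X1 X2). Qed.

Lemma measurable_comp_RV X (f : T -> R) :
  measurable_fun setT f -> measurable_fun setT (fun w => f (X w)).
Proof. by move=> mf; exact: measurableT_comp. Qed.

(** The joint law and the product measure agree on rectangles, hence
    everywhere; the rest is Tonelli. *)
Lemma ge0_integral_iid X1 X2 Q (f : T * T -> \bar R) :
  iid_pair X1 X2 Q -> measurable_fun setT f -> (forall z, 0 <= f z)%E ->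
  (\int[Pr]_w f (X1 w, X2 w) = \int[Q]_x \int[Q]_y f (x, y))%E.
Proof.
move=> [X1Q X2Q X12] mf f0.
pose X : {mfun Omega >-> (T * T)%type} :=
  HB.pack (fun w => (X1 w, X2 w))
    (isMeasurableFun.Build _ _ _ _ _ (measurable_pair X1 X2)).
transitivity (\int[Pr]_w (f \o X) w)%E; first by [].
rewrite -(ge0_integral_distribution (P := Pr) X mf f0).
rewrite -[RHS](fubini_tonelli1 f mf f0).
apply: eq_measure_integral => A mA _; apply/esym.
apply: product_measure_unique => // B C mB mC.
rewrite /= /distribution /pushforward -X1Q// -X2Q//.
exact: X12.
Qed.

Lemma ge0_integral_law X1 X2 Q (f : T -> \bar R) :
  iid_pair X1 X2 Q -> measurable_fun setT f -> (forall z, 0 <= f z)%E ->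
  (\int[Pr]_w f (X1 w) = \int[Q]_x f x)%E.
Proof.
move=> [X1Q _ _] mf f0.
rewrite -[LHS](ge0_integral_distribution (P := Pr) X1 mf f0).
by apply: eq_measure_integral => A mA _; exact: X1Q.
Qed.

Local Notation N r f := (Lnorm Pr r%:E (fun w => (f w)%:E)).

(** Exchangeability: both orders have the product law. *)
Lemma iid_Lnorm_swap X1 X2 Q (h : T -> T -> R) r :
  iid_pair X1 X2 Q -> measurable_fun setT (fun z : T * T => h z.1 z.2) ->
  N r (fun w => h (X1 w) (X2 w)) = N r (fun w => h (X2 w) (X1 w)).
Proof.
move=> X12 mh; rewrite !LnormE; congr (_ `^ _)%E.
have mf : measurable_fun setT (fun z : T * T => (`|h z.1 z.2| `^ r)%:E).
  apply/measurable_EFinP; apply: (measurableT_comp (measurable_powR r)).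
  exact: measurableT_comp.
have f0 (z : T * T) : (0 <= (`|h z.1 z.2| `^ r)%:E)%E.
  by rewrite lee_fin powR_ge0.
have := ge0_integral_iid X12 mf f0.
by rewrite -(ge0_integral_iid (iid_pairC X12) mf f0).
Qed.

Lemma iid_Lnorm_law X1 X2 Q (f : T -> R) r :
  iid_pair X1 X2 Q -> measurable_fun setT f ->
  N r (fun w => f (X1 w)) = N r (fun w => f (X2 w)).
Proof.
move=> X12 mf; apply: (iid_Lnorm_swap (h := fun x _ => f x) r X12).
exact: measurableT_comp.
Qed.

Lemma iid_Lnorm_prod X1 X2 Q (f g : T -> R) r :
  iid_pair X1 X2 Q -> measurable_fun setT f -> measurable_fun setT g ->
  N r (fun w => f (X1 w) * g (X2 w))
  = (N r (fun w => f (X1 w)) * N r (fun w => g (X2 w)))%E.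
Proof.
move=> X12 mf mg; rewrite !LnormE.
have pow0 (x : R) : (0 <= (`|x| `^ r)%:E)%E by rewrite lee_fin powR_ge0.
have mpow (k : T -> R) : measurable_fun setT k ->
    measurable_fun setT (fun x => (`|k x| `^ r)%:E).
  move=> mk; apply/measurable_EFinP.
  apply: (measurableT_comp (measurable_powR r)).
  exact: measurableT_comp.
rewrite -poweRM; [|by apply: integral_ge0..]; congr (_ `^ _)%E.
rewrite (ge0_integral_law X12 (mpow _ mf))//.
rewrite (ge0_integral_law (iid_pairC X12) (mpow _ mg))//.
have mfg : measurable_fun setT
    (fun z : T * T => (`|f z.1 * g z.2| `^ r)%:E).
  apply/measurable_EFinP; apply: (measurableT_comp (measurable_powR r)).
  apply: measurableT_comp => //.
  apply: measurable_funM; exact: measurableT_comp.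
rewrite (ge0_integral_iid X12 mfg)// -ge0_integralZr//.
- apply: eq_integral => x _; rewrite -ge0_integralZl//; last exact: mpow.
  by apply: eq_integral => y _; rewrite normrM powRM// EFinM.
- exact: mpow.
- exact: integral_ge0.
Qed.

End iid.

(** * Euclidean vectors, and measurability of derivatives *)

Section euclidean.
Context {R : realType} {d : nat}.
Implicit Types u v w : 'rV[R]_d.

Lemma dotrv_ge0 u : 0 <= dotrv u u.
Proof. by apply: sumr_ge0 => l _; rewrite -expr2 sqr_ge0. Qed.

Lemma norm2_ge0 u : 0 <= norm2 u.
Proof. exact: sqrtr_ge0. Qed.

Lemma dotrvC u v : dotrv u v = dotrv v u.
Proof. by apply: eq_bigr => l _; rewrite mulrC. Qed.

Lemma dotrvDl u v w : dotrv (u + v) w = dotrv u w + dotrv v w.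
Proof. by rewrite -big_split; apply: eq_bigr => l _; rewrite mxE mulrDl. Qed.

Lemma dotrvZl (c : R) u v : dotrv (c *: u) v = c * dotrv u v.
Proof. by rewrite big_distrr; apply: eq_bigr => l _; rewrite mxE /= mulrA. Qed.

Lemma dotrvBl u v w : dotrv (u - v) w = dotrv u w - dotrv v w.
Proof. by rewrite dotrvDl -scaleN1r dotrvZl mulN1r. Qed.

Lemma dotrv_suml (I : Type) (s : seq I) (F : I -> 'rV[R]_d) v :
  dotrv (\sum_(i <- s) F i) v = \sum_(i <- s) dotrv (F i) v.
Proof.
elim: s => [|i s IH]; last by rewrite !big_cons dotrvDl IH.
by rewrite !big_nil -(scale0r v) dotrvZl mul0r.
Qed.

(** Cauchy-Schwarz: expand the nonnegative square of (u.u) v - (u.v) u. *)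
Lemma normr_dotrv_le u v : `|dotrv u v| <= norm2 u * norm2 v.
Proof.
rewrite /norm2 -sqrtrM ?dotrv_ge0// -sqrtr_sqr ler_wsqrtr//.
set a := dotrv u u; set b := dotrv v v; set c := dotrv u v.
have a0 : 0 <= a by exact: dotrv_ge0.
have : 0 <= a * (a * b - c ^+ 2).
  have := dotrv_ge0 (a *: v - c *: u).
  rewrite dotrvBl !dotrvZl ![dotrv _ (_ - _)]dotrvC !dotrvBl !dotrvZl.
  rewrite (dotrvC v u) -/a -/b -/c => H; apply: le_trans H _.
  by rewrite le_eqVlt; apply/orP; left; apply/eqP; ring.
have [a_gt0|] := ltrP 0 a; first by rewrite pmulr_rge0// subr_ge0.
move=> a_le0 _; suff -> : c = 0 by rewrite expr0n mulr_ge0// dotrv_ge0.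
have u0 : forall l, true -> u 0 l * u 0 l = 0.
  apply: psumr_eq0P => [i _|]; first by rewrite -expr2 sqr_ge0.
  by apply/le_anti; rewrite a_le0 a0.
apply: big1 => l _.
by have /eqP := u0 l isT; rewrite mulf_eq0 orbb => /eqP ->; rewrite mul0r.
Qed.

Lemma normr_coord_le_norm2 u l : `|u 0 l| <= norm2 u.
Proof.
rewrite /norm2 -sqrtr_sqr ler_wsqrtr// /dotrv (bigD1 l)//= expr2 lerDl.
by apply: sumr_ge0 => i _; rewrite -expr2 sqr_ge0.
Qed.

End euclidean.

Section borel.
Context {R : realType} {d : nat}.
Local Notation V := 'rV[R]_d.

Lemma continuous_measurable_rV (f : V -> R) :
  continuous f -> measurable_fun setT f.
Proof.
move=> /continuousP cf.
apply: (measurability _ (RGenOpens.measurableE R)) => // _ [_ [x [y ->]] <-].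
rewrite setTI; apply: sub_sigma_algebra; apply: cf; exact: itv_open.
Qed.

Lemma continuous_measurable_rVV (f : V -> V) :
  continuous f -> measurable_fun setT f.
Proof.
move=> /continuousP cf.
have mE : @measurable _ V = <<s open >> by [].
apply: (measurability _ mE) => // _ [A oA <-].
rewrite setTI; apply: sub_sigma_algebra; exact: cf.
Qed.

(** A directional derivative is the limit of the difference quotients with
    step 1/(n+1); it is thus measurable as soon as they are, here in a
    parameter t that may also move the base point. *)
Lemma measurable_partial dT (T : measurableType dT) (l : 'I_d)
    (F : T -> V -> R) (b : T -> V) :
  (forall h : R,
    measurable_fun setT (fun t => F t (h *: delta_mx 0 l + b t))) ->
  (forall t, differentiable (F t) (b t)) ->
  measurable_fun setT (fun t => partial l (F t) (b t)).
Proof.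
move=> mF dF.
pose e n : R := n.+1%:R^-1.
apply: (@measurable_fun_cvg _ _ _ _ (fun n t =>
    (e n)^-1 * (F t (e n *: delta_mx 0 l + b t) - F t (b t)))).
  move=> n; apply: measurable_funM => //; apply: measurable_funB => //.
  have := mF 0; congr measurable_fun; apply/funext => t.
  by rewrite scale0r add0r.
move=> t _.
have /cvgr_dnbhsP/(_ e) :=
  @diff_derivable _ _ _ (F t) (b t) (delta_mx 0 l) (dF t).
apply; split; last exact: cvg_harmonic.
by move=> n; rewrite /e invr_eq0 pnatr_eq0.
Qed.

End borel.

Section derivatives.
Context {R : realType} {d : nat}.
Local Notation V := 'rV[R]_d.

Section parametric.
Context {dT : measure_display} {T : measurableType dT}.
Implicit Types U W : T -> V.

Lemma measurable_dotrv U W :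
  (forall l, measurable_fun setT (fun t => U t 0 l)) ->
  (forall l, measurable_fun setT (fun t => W t 0 l)) ->
  measurable_fun setT (fun t => dotrv (U t) (W t)).
Proof. by move=> mU mW; apply: measurable_sum => l; apply: measurable_funM. Qed.

Lemma measurable_norm2 U :
  (forall l, measurable_fun setT (fun t => U t 0 l)) ->
  measurable_fun setT (fun t => norm2 (U t)).
Proof.
move=> mU.
have msqrt : measurable_fun setT (@Num.sqrt R).
  by apply: continuous_measurable_fun => x; exact: sqrt_continuous.
exact: measurableT_comp msqrt (measurable_dotrv mU mU).
Qed.

End parametric.

Lemma continuous_line (v : V) (h : R) : continuous (fun x : V => h *: v + x).
Proof.
move=> x; apply: (@continuousD _ _ _ (fun=> h *: v) id).
  exact: cst_continuous.
exact: cvg_id.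
Qed.

Let mshift (v : V) (h : R) : measurable_fun setT (fun x : V => h *: v + x).
Proof. by apply: continuous_measurable_rVV; apply: continuous_line. Qed.

Lemma measurable_differentiable (f : V -> R) :
  (forall x, differentiable f x) -> measurable_fun setT f.
Proof.
move=> df; apply: continuous_measurable_rV => x.
exact: differentiable_continuous.
Qed.

Lemma measurable_grad (f : V -> R) l : (forall x, differentiable f x) ->
  measurable_fun setT (fun x => grad f x 0 l).
Proof.
move=> df; under eq_fun do rewrite mxE.
apply: (measurable_partial (F := fun=> f) (b := id)) => // h.
exact: measurableT_comp (measurable_differentiable df) (mshift _ _).
Qed.

Section kernel.
Context (K : V -> V -> R)
  (mK : measurable_fun setT (fun z : V * V => K z.1 z.2)).

(** Measurability is for the product sigma-algebra, as the law of a pair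
    requires. It comes from that of K through difference quotients, which avoids
    identifying the product sigma-algebra with the Borel sets of the product
    space. *)
Lemma measurable_grad1 l : (forall x x', differentiable (K ^~ x') x) ->
  measurable_fun setT (fun z : V * V => grad1 K z.1 z.2 0 l).
Proof.
move=> dK; under eq_fun do rewrite mxE.
apply: (measurable_partial
  (F := fun (z : V * V) y => K y z.2) (b := fst)) => // h.
suff mline : measurable_fun setT
    (fun z : V * V => (h *: delta_mx 0 l + z.1, z.2)).
  exact: measurableT_comp mK mline.
apply: measurable_fun_pair => //; exact: measurableT_comp (mshift _ _) _.
Qed.

Lemma measurable_grad2 l : (forall x x', differentiable (K x) x') ->
  measurable_fun setT (fun z : V * V => grad2 K z.1 z.2 0 l).
Proof.
move=> dK; under eq_fun do rewrite mxE.
apply: (measurable_partial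
  (F := fun (z : V * V) y => K z.1 y) (b := snd)) => // h.
suff mline : measurable_fun setT
    (fun z : V * V => (z.1, h *: delta_mx 0 l + z.2)).
  exact: measurableT_comp mK mline.
apply: measurable_fun_pair => //; exact: measurableT_comp (mshift _ _) _.
Qed.

End kernel.

Lemma measurable_tr_grad12 (K : V -> V -> R) :
  measurable_fun setT (fun z : V * V => K z.1 z.2) ->
  (forall x x', differentiable (K x) x') ->
  (forall x x', differentiable (fun y => grad2 K y x') x) ->
  measurable_fun setT (fun z : V * V => \tr (grad12 K z.1 z.2)).
Proof.
move=> mK dK2 dK12; apply: measurable_sum => i; under eq_fun do rewrite mxE.
have := @measurable_grad1 (fun x x' => grad2 K x x' 0 i)
  (measurable_grad2 mK i dK2) i.
rewrite /grad1; under eq_fun do rewrite mxE; apply => x x'.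
exact: differentiable_comp (dK12 x x') (differentiable_coord _ _ _).
Qed.

Lemma measurable_score (p : V -> R) l : (forall x, 0 < p x) ->
  (forall x, differentiable p x) ->
  measurable_fun setT (fun x => score p x 0 l).
Proof.
move=> p0 dp; apply: measurable_grad => x.
apply: differentiable_comp => //; apply/derivable1_diffP.
by apply: ex_derive; exact: is_derive1_ln.
Qed.

(** The kernel is an inner product of features, and a real inner product is
    symmetric. *)
Lemma psd_kernel_sym (K : V -> V -> R) x x' :
  measurable_psd_kernel K -> K x x' = K x' x.
Proof.
by move=> [_ [H [ip [feat [_ KE]]]]]; rewrite !KE hermC expr0 mul1r.
Qed.

Lemma grad2_psd_kernel (K : V -> V -> R) x x' :
  measurable_psd_kernel K -> grad2 K x x' = grad1 K x' x.
Proof.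
by move=> psdK; congr grad; apply/funext => y; exact: psd_kernel_sym.
Qed.

End derivatives.

(** * The Stein operator and the Mercer sums *)

Lemma sum_blocks (V : zmodType) (F : nat -> V) d q r :
  \sum_(k < q * d + r) F k
  = \sum_(k < q) \sum_(l < d) F (k * d + l)%N + \sum_(l < r) F (q * d + l)%N.
Proof.
rewrite big_split_ord; congr (_ + _).
elim: q => [|q IH]; first by rewrite !big_ord0.
by rewrite mulSnr big_split_ord IH big_ord_recr.
Qed.

Lemma invf2D (F : numFieldType) (a : F) : (2 * a)^-1 + (2 * a)^-1 = a^-1.
Proof.
by rewrite invfM -mulrDl -mulr2n -(mulr_natl 2^-1) mulfV ?mul1r ?pnatr_eq0.
Qed.

(** The exponent nu ( nu + nus ) / ( nus - nu ) is the one that Hoelder's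
    inequality pairs with the midpoint of nu and nus to reach nu. *)
Lemma hoelder_exponents (F : realFieldType) (nu nus : F) : 0 < nu -> nu < nus ->
  let m := nu * (nu + nus) / (nus - nu) in
  [/\ nu <= m, 0 < (nu + nus) / 2, (nu + nus) / 2 < nus
    & m^-1 + ((nu + nus) / 2)^-1 = nu^-1].
Proof.
move=> nu0 nus_gt m; split; [|lra..|].
- by rewrite /m -mulrA ler_peMr ?(ltW nu0)// ler_pdivlMr; lra.
- by rewrite /m; field; rewrite !gt_eqF//; lra.
Qed.

Lemma cvg_divn d : (0 < d)%N -> (K %/ d)%N @[K --> \oo] --> \oo.
Proof.
move=> d0 A [n _ nA]; exists (n * d)%N => // K /= nK.
by apply: nA => /=; rewrite leq_divRL.
Qed.

Definition kernel_err (R : realType) (T : Type) (kappa : T -> T -> R)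
    (lam : nat -> R) (phi : nat -> T -> R) q x y : R :=
  \sum_(k < q) lam k * phi k x * phi k y - kappa x y.

Section stein.
Context {R : realType} {d : nat}.
Local Notation V := 'rV[R]_d.
Implicit Types (p f : V -> R) (x y : V) (kappa : V -> V -> R).
Implicit Types (lam : nat -> R) (phi : nat -> V -> R).

(** The Langevin Stein operator in its vector form; psi_(k d + l) is the l-th
    coordinate of its value at phi_k. *)
Definition stein p f x : V := f x *: score p x + grad f x.

Lemma stein_coord p f x l :
  stein p f x 0 l = partial l (fun y => ln (p y)) x * f x + partial l f x.
Proof. by rewrite !mxE mulrC. Qed.

Lemma dotrvDZ (a b : R) (u v g h : V) :
  dotrv (a *: u + g) (b *: v + h)
  = dotrv u v * (a * b) + dotrv u (a *: h) + dotrv v (b *: g) + dotrv g h.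
Proof.
rewrite dotrvDl dotrvZl !(dotrvC _ (b *: v + h)) !dotrvDl !dotrvZl.
rewrite (dotrvC u (a *: h)) (dotrvC v (b *: g)) !dotrvZl.
by rewrite (dotrvC v u) (dotrvC v g) (dotrvC h u) (dotrvC h g); ring.
Qed.

Definition grad_err kappa lam phi q x y : V :=
  \sum_(k < q) (lam k * phi k y) *: grad (phi k) x - grad1 kappa x y.

Definition trace_err kappa lam phi q x y : R :=
  \sum_(k < q) lam k * dotrv (grad (phi k) x) (grad (phi k) y)
  - \tr (grad12 kappa x y).

(** u_KSD is kappa with the Stein operator applied formally in each argument, so
    the error of q complete blocks splits along its four terms; the symmetry of
    kappa turns the gradient in the second argument into one in the first. *)
Lemma stein_sum_err p kappa lam phi q x y : measurable_psd_kernel kappa ->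
  \sum_(k < q) lam k * dotrv (stein p (phi k) x) (stein p (phi k) y)
  - u_KSD p kappa x y
  = dotrv (score p x) (score p y) * kernel_err kappa lam phi q x y
    + dotrv (score p x) (grad_err kappa lam phi q y x)
    + dotrv (score p y) (grad_err kappa lam phi q x y)
    + trace_err kappa lam phi q x y.
Proof.
move=> psdK; rewrite /u_KSD grad2_psd_kernel// /kernel_err /grad_err /trace_err.
rewrite !(dotrvC _ (_ - _)) !dotrvBl !dotrv_suml mulrBr.
rewrite !(dotrvC (grad1 _ _ _)).
set S1 := \sum_(k < q) lam k * phi k x * phi k y.
set S2 := \sum_(i < q) dotrv ((lam i * phi i x) *: _) _.
set S3 := \sum_(i < q) dotrv ((lam i * phi i y) *: _) _.
set S4 := \sum_(k < q) lam k * dotrv (grad _ x) (grad _ y).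
suff -> : \sum_(k < q) lam k * dotrv (stein p (phi k) x) (stein p (phi k) y)
    = dotrv (score p x) (score p y) * S1 + S2 + S3 + S4 by ring.
rewrite /S1 big_distrr/= -!big_split/=; apply: eq_bigr => k _.
rewrite dotrvDZ !dotrvZl (dotrvC (score p x) (_ *: _)).
by rewrite (dotrvC (score p y) (_ *: _)) !dotrvZl; ring.
Qed.

(** A bound of all the coordinates of stein p f x, built so that Minkowski's and
    Hoelder's inequalities separate the moments of the score, of f and of its
    gradient. *)
Definition stein_dom p f x : R :=
  norm2 (score p x) * `|f x| + norm2 (grad f x).

Lemma stein_coord_le p f x l : `|stein p f x 0 l| <= stein_dom p f x.
Proof.
rewrite /stein 2!mxE (le_trans (ler_normD _ _))//.
rewrite lerD ?normr_coord_le_norm2// normrM mulrC ler_wpM2r//.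
exact: normr_coord_le_norm2.
Qed.

Lemma stein_dom_ge0 p f x : 0 <= stein_dom p f x.
Proof. by rewrite addr_ge0 ?mulr_ge0 ?norm2_ge0. Qed.

(** Only the last block can be incomplete; it has fewer than d terms. *)
Lemma stein_partial_sum_le p kappa lam phi (alpha : nat -> R)
    (psi : nat -> V -> R) q r x y :
  (r < d)%N -> (forall k, 0 <= lam k) ->
  (forall k (l : 'I_d), alpha (k * d + l)%N = lam k) ->
  (forall k (l : 'I_d) x, psi (k * d + l)%N x = stein p (phi k) x 0 l) ->
  `|\sum_(k < q * d + r) alpha k * psi k x * psi k y - u_KSD p kappa x y|
  <= `|\sum_(k < q) lam k * dotrv (stein p (phi k) x) (stein p (phi k) y)
       - u_KSD p kappa x y|
     + d%:R * lam q * (stein_dom p (phi q) x * stein_dom p (phi q) y).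
Proof.
move=> rd lam0 alphaE psiE.
rewrite (sum_blocks (fun k => alpha k * psi k x * psi k y)) addrAC.
apply: le_trans (ler_normD _ _) _; apply: lerD.
  rewrite (_ : \sum_(k < q) _ = \sum_(k < q) lam k *
    dotrv (stein p (phi k) x) (stein p (phi k) y))//.
  apply: eq_bigr => k _; rewrite big_distrr/=; apply: eq_bigr => l _.
  by rewrite alphaE !psiE mulrA.
apply: le_trans (ler_norm_sum _ _ _) _.
apply: (@le_trans _ _ (\sum_(l < r) lam q *
    (stein_dom p (phi q) x * stein_dom p (phi q) y))).
  apply: ler_sum => l _.
  have ld : (l < d)%N by apply: ltn_trans (ltn_ord l) rd.
  have -> : (q * d + l = q * d + Ordinal ld)%N by [].
  rewrite alphaE !psiE !normrM (ger0_norm (lam0 q)) -mulrA ler_wpM2l//.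
  by rewrite ler_pM ?stein_coord_le.
rewrite sumr_const card_ord -(mulr_natl (lam q * _)) -[leRHS]mulrA ler_wpM2r//.
  by rewrite !mulr_ge0 ?stein_dom_ge0.
by rewrite ler_nat ltnW.
Qed.

End stein.

Lemma ge0_ereal_sup_lty_ub (R : realType) (I : Type) (F : I -> \bar R)
    (A : set I) :
  (forall i, 0 <= F i)%E -> (ereal_sup [set F i | i in A] < +oo)%E ->
  exists C : R, 0 <= C /\ (forall i, A i -> (F i <= C%:E)%E).
Proof.
move=> F0 supF; exists (Num.max 0 (fine (ereal_sup [set F i | i in A]))).
split=> [|i Ai]; first by rewrite le_max lexx.
have Fi : (F i <= ereal_sup [set F i | i in A])%E.
  by apply: ereal_sup_ubound; exists i.
rewrite (le_trans Fi)// EFin_max.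
rewrite fineK ?le_max ?lexx ?orbT//.
by rewrite ge0_fin_numE// (le_trans (F0 i) Fi).
Qed.

Section mercer.
Context {R : realType} {dO dT : measure_display} {Omega : measurableType dO}
  {T : measurableType dT} {Pr : probability Omega R} (X1 X2 : {RV Pr >-> T}).
Local Notation N r f := (Lnorm Pr r%:E (fun w => (f w)%:E)).
Context (kappa : T -> T -> R) (lam : nat -> R) (phi : nat -> T -> R).

Lemma measurable_kernel_err q :
  measurable_fun setT (fun z : T * T => kappa z.1 z.2) ->
  (forall k, measurable_fun setT (phi k)) ->
  measurable_fun setT (fun z : T * T => kernel_err kappa lam phi q z.1 z.2).
Proof.
move=> mkappa mphi; apply: measurable_funB => //; apply: measurable_sum => k.
by apply: measurable_funM; [apply: measurable_funM => //|];
  exact: measurableT_comp.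
Qed.

(** Almost sure convergence together with the uniform bound in L_nus gives
    convergence in every lower norm. *)
Lemma cvg_kernel_err r nus (Q : probability T R) :
  measurable_fun setT (fun z : T * T => kappa z.1 z.2) ->
  (forall k, measurable_fun setT (phi k)) ->
  0 < r -> r < nus -> 1 <= nus ->
  weak_mercer X1 X2 Q kappa lam phi ->
  (N nus (fun w => kappa (X1 w) (X2 w)) < +oo)%E ->
  (ereal_sup [set N nus (fun w =>
       \sum_(k < K) lam k * phi k (X1 w) * phi k (X2 w))
     | K in [set K : nat | (1 <= K)%N]] < +oo)%E ->
  N r (fun w => kernel_err kappa lam phi q (X1 w) (X2 w)) @[q --> \oo] --> 0%E.
Proof.
move=> mkappa mphi r0 rnus nus1 [_ _ _ cvg_ae] kappa_nus sum_nus.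
have mX := measurable_pair X1 X2.
have merr q : measurable_fun setT
    (fun w => kernel_err kappa lam phi q (X1 w) (X2 w)).
  exact: measurableT_comp (measurable_kernel_err q mkappa mphi) mX.
have mk : measurable_fun setT (fun w => kappa (X1 w) (X2 w)).
  exact: measurableT_comp mkappa mX.
have [C [C0 sumC]] := ge0_ereal_sup_lty_ub (fun K => Lnorm_ge0 _ _ _) sum_nus.
pose Ck := fine (N nus (fun w => kappa (X1 w) (X2 w))).
apply: (@cvg_Lnorm0_bounded _ _ _ _ _ r nus (C + Ck)) => //.
  by apply: filterS cvg_ae => w; exact: norm_cvg0.
move=> q; rewrite EFinD /Ck fineK ?ge0_fin_numE ?Lnorm_ge0//.
set S := fun w => \sum_(k < q) lam k * phi k (X1 w) * phi k (X2 w).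
have mS : measurable_fun setT S.
  have -> : S = (fun w => kernel_err kappa lam phi q (X1 w) (X2 w)
      + kappa (X1 w) (X2 w)).
    by apply/funext => w; rewrite /kernel_err subrK.
  exact: measurable_funD.
have mkN : measurable_fun setT (fun w => - kappa (X1 w) (X2 w)).
  exact: measurableT_comp.
apply: (le_trans (minkowski Pr mS mkN nus1)).
apply: leeD; last first.
  by rewrite -[leLHS]oppe_Lnorm; under eq_Lnorm do rewrite /= opprK.
(* the supremum is over q >= 1, and the empty sum has norm 0 *)
case: q @S mS => [|q] S mS; last exact: (sumC q.+1).
rewrite [leLHS](_ : _ = 0%E) ?lee_fin//.
rewrite -[RHS](Lnorm0 Pr (p := nus%:E)) ?eqe ?gt_eqF ?(lt_le_trans ltr01)//.
by apply: eq_Lnorm => w; rewrite /S /= big_ord0.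
Qed.

End mercer.

Section terms.
Context {R : realType} {d : nat} {dO : measure_display}
  {Omega : measurableType dO} {Pr : probability Omega R}.
Local Notation V := 'rV[R]_d.
Local Notation N r f := (Lnorm Pr r%:E (fun w => (f w)%:E)).
Implicit Types (p f : V -> R) (kappa : V -> V -> R).
Implicit Types (lam : nat -> R) (phi : nat -> V -> R).

Lemma measurable_grad_err kappa lam phi q l :
  measurable_fun setT (fun z : V * V => kappa z.1 z.2) ->
  (forall x x', differentiable (kappa ^~ x') x) ->
  (forall k x, differentiable (phi k) x) ->
  measurable_fun setT (fun z : V * V => grad_err kappa lam phi q z.1 z.2 0 l).
Proof.
move=> mkappa dkappa dphi.
under eq_fun do rewrite mxE mxE summxE.
apply: measurable_funB; last exact: measurable_grad1.
apply: measurable_sum => k; under eq_fun do rewrite mxE.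
apply: measurable_funM.
  apply: measurable_funM => //.
  exact: measurableT_comp (measurable_differentiable (dphi k)) measurable_snd.
exact: measurableT_comp (measurable_grad l (dphi k)) measurable_fst.
Qed.

Lemma measurable_trace_err kappa lam phi q :
  measurable_fun setT (fun z : V * V => kappa z.1 z.2) ->
  (forall x x', differentiable (kappa x) x') ->
  (forall x x', differentiable (fun y => grad2 kappa y x') x) ->
  (forall k x, differentiable (phi k) x) ->
  measurable_fun setT (fun z : V * V => trace_err kappa lam phi q z.1 z.2).
Proof.
move=> mkappa dkappa2 dkappa12 dphi.
apply: measurable_funB; last exact: measurable_tr_grad12.
apply: measurable_sum => k; apply: measurable_funM => //.
apply: measurable_dotrv => l.
  exact: measurableT_comp (measurable_grad l (dphi k)) measurable_fst.
exact: measurableT_comp (measurable_grad l (dphi k)) measurable_snd.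
Qed.

Lemma measurable_stein_dom p f : (forall x, 0 < p x) ->
  (forall x, differentiable p x) -> (forall x, differentiable f x) ->
  measurable_fun setT (stein_dom p f).
Proof.
move=> p0 dp df; apply: measurable_funD; last first.
  by apply: measurable_norm2 => l; exact: measurable_grad.
apply: measurable_funM.
  by apply: measurable_norm2 => l; exact: measurable_score.
apply: measurableT_comp => //; exact: measurable_differentiable.
Qed.

Lemma measurable_stein p f l : (forall x, 0 < p x) ->
  (forall x, differentiable p x) -> (forall x, differentiable f x) ->
  measurable_fun setT (fun x => stein p f x 0 l).
Proof.
move=> p0 dp df; under eq_fun do rewrite mxE mxE.
apply: measurable_funD; last exact: measurable_grad.
apply: measurable_funM; first exact: measurable_differentiable.
exact: measurable_score.
Qed.

(** Cauchy-Schwarz pointwise, then Hoelder with exponents 2 nu and 2 nu. *)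
Lemma cvg_Lnorm0_dotrv (U : Omega -> V) (W_ : nat -> Omega -> V) nu : 0 < nu ->
  (forall l, measurable_fun setT (fun w => U w 0 l)) ->
  (forall n l, measurable_fun setT (fun w => W_ n w 0 l)) ->
  (N (2 * nu) (fun w => norm2 (U w)) < +oo)%E ->
  N (2 * nu) (fun w => norm2 (W_ n w)) @[n --> \oo] --> 0%E ->
  N nu (fun w => dotrv (U w) (W_ n w)) @[n --> \oo] --> 0%E.
Proof.
move=> nu0 mU mW Uoo W0.
apply: (cvg_Lnorm0_le (g_ := fun n w => norm2 (U w) * norm2 (W_ n w)) nu0).
- by move=> n; exact: measurable_dotrv.
- by move=> n; apply: measurable_funM; exact: measurable_norm2.
- by move=> n w; exact: normr_dotrv_le.
apply: (cvg_Lnorm0M (p := 2 * nu) (q := 2 * nu) nu0 _ _ _ _ _ Uoo W0).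
- by rewrite mulr_gt0.
- by rewrite mulr_gt0.
- exact: invf2D.
- exact: measurable_norm2.
- by move=> n; exact: measurable_norm2.
Qed.

Lemma cvg_Lnorm0_dotrvM (U W : Omega -> V) (D_ : nat -> Omega -> R) nu m q :
  0 < nu -> 0 < m -> 0 < q -> m^-1 + q^-1 = nu^-1 ->
  (forall l, measurable_fun setT (fun w => U w 0 l)) ->
  (forall l, measurable_fun setT (fun w => W w 0 l)) ->
  (forall n, measurable_fun setT (D_ n)) ->
  (N (2 * m) (fun w => norm2 (U w)) < +oo)%E ->
  (N (2 * m) (fun w => norm2 (W w)) < +oo)%E ->
  N q (D_ n) @[n --> \oo] --> 0%E ->
  N nu (fun w => dotrv (U w) (W w) * D_ n w) @[n --> \oo] --> 0%E.
Proof.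
move=> nu0 m0 q0 mq mU mW mD Uoo Woo D0.
have m20 : 0 < 2 * m by rewrite mulr_gt0.
have mnU := measurable_norm2 mU.
have mnW := measurable_norm2 mW.
have mUW := measurable_dotrv mU mW.
apply: (cvg_Lnorm0M nu0 m0 q0 mq mUW mD _ D0).
have UWoo : (N (2 * m) (fun w => norm2 (U w))
    * N (2 * m) (fun w => norm2 (W w)) < +oo)%E.
  by rewrite lte_mul_pinfty ?Lnorm_ge0// ge0_fin_numE ?Lnorm_ge0.
apply: le_lt_trans UWoo.
apply: le_trans (hoelder_gen Pr m0 m20 m20 (invf2D m) mnU mnW).
apply: (le_Lnorm Pr m0 mUW (measurable_funM mnU mnW)) => w.
exact: normr_dotrv_le.
Qed.

Lemma Lnorm_stein_dom_le p f (X : {RV Pr >-> V}) nu (S Cphi Cdphi : R) :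
  1 <= nu ->
  (forall x, 0 < p x) -> (forall x, differentiable p x) ->
  (forall x, differentiable f x) ->
  (N (2 * nu) (fun w => norm2 (score p (X w))) <= S%:E)%E ->
  (N (2 * nu) (fun w => f (X w)) <= Cphi%:E)%E ->
  (N nu (fun w => norm2 (grad f (X w))) <= Cdphi%:E)%E ->
  (N nu (fun w => stein_dom p f (X w)) <= (S * Cphi + Cdphi)%:E)%E.
Proof.
move=> nu1 p0 dp df HS Hphi Hdphi.
have nu0 : 0 < nu by exact: lt_le_trans nu1.
have mX : measurable_fun setT (X : Omega -> V) by [].
have ms : measurable_fun setT (fun w => norm2 (score p (X w))).
  apply: measurable_norm2 => l.
  exact: measurableT_comp (measurable_score l p0 dp) mX.
have mf : measurable_fun setT (fun w => `|f (X w)|).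
  apply: measurableT_comp => //.
  exact: measurableT_comp (measurable_differentiable df) mX.
have mg : measurable_fun setT (fun w => norm2 (grad f (X w))).
  apply: measurable_norm2 => l.
  exact: measurableT_comp (measurable_grad l df) mX.
apply: (le_trans (minkowski Pr (measurable_funM ms mf) mg nu1)).
rewrite EFinD; apply: leeD => //.
apply: (@le_trans _ _ (N (2 * nu) (fun w => norm2 (score p (X w)))
    * N (2 * nu) (fun w => `|f (X w)|%R))%E).
  by apply: hoelder_gen; rewrite ?mulr_gt0 ?invf2D.
rewrite (EFinM S); apply: lee_pmul; rewrite ?Lnorm_ge0//.
suff -> : N (2 * nu) (fun w => `|f (X w)|%R) = N (2 * nu) (fun w => f (X w)).
  exact: Hphi.
exact: (Lnorm_abse Pr (fun w => (f (X w))%:E)).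
Qed.

(** The weight lam_q tends to 0, and by independence the norm of the product is
    the product of the norms, which are bounded. *)
Lemma cvg_Lnorm0_remainder p phi lam (X1 X2 : {RV Pr >-> V}) Q nu (c C : R) :
  0 < nu -> iid_pair X1 X2 Q ->
  (forall x, 0 < p x) -> (forall x, differentiable p x) ->
  (forall k x, differentiable (phi k) x) ->
  lam @ \oo --> 0 ->
  (forall k, N nu (fun w => stein_dom p (phi k) (X1 w)) <= C%:E)%E ->
  N nu (fun w => c * lam q *
    (stein_dom p (phi q) (X1 w) * stein_dom p (phi q) (X2 w)))
    @[q --> \oo] --> 0%E.
Proof.
move=> nu0 X12 p0 dp dphi lam0 HC.
have mD k := measurable_stein_dom p0 dp (dphi k).
apply: (@ge0_squeeze_cvge0 _ _ (fun q => (`|c * lam q| * (C * C))%:E)).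
- by move=> q; exact: Lnorm_ge0.
- move=> q; rewrite LnormZ_real//; last first.
    by apply: measurable_funM; exact: measurableT_comp.
  rewrite (iid_Lnorm_prod _ X12)// EFinM lee_wpmul2l ?lee_fin//.
  rewrite EFinM lee_pmul ?Lnorm_ge0//.
  by rewrite -(iid_Lnorm_law _ X12).
- apply: cvg_EFin; first exact: nearW.
  rewrite -[X in _ --> X](mul0r (C * C)); apply: cvgMl.
  rewrite -[X in _ --> X](normr0 R); apply: cvg_norm.
  by rewrite -[X in _ --> X](mulr0 c); apply: cvgMr.
Qed.

Lemma measurable_u_KSD p kappa : (forall x, 0 < p x) ->
  (forall x, differentiable p x) ->
  measurable_psd_kernel kappa -> kernel_C1 kappa ->
  measurable_fun setT (fun z : V * V => u_KSD p kappa z.1 z.2).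
Proof.
move=> p0 dp [mK _] [dk1 dk2 dk12 _].
have ms1 l : measurable_fun setT (fun z : V * V => score p z.1 0 l).
  exact: measurableT_comp (measurable_score l p0 dp) measurable_fst.
have ms2 l : measurable_fun setT (fun z : V * V => score p z.2 0 l).
  exact: measurableT_comp (measurable_score l p0 dp) measurable_snd.
apply: measurable_funD; last exact: measurable_tr_grad12.
apply: measurable_funD.
  apply: measurable_funD.
    by apply: measurable_funM => //; exact: measurable_dotrv.
  by apply: measurable_dotrv => // l; exact: measurable_grad2.
by apply: measurable_dotrv => // l; exact: measurable_grad1.
Qed.

(** The four terms of stein_sum_err tend to 0 separately. *)
Lemma cvg_stein_sum_err (Q : probability V R) (X1 X2 : {RV Pr >-> V}) p kappa
    lam phi nu m q :
  0 < nu -> 0 < m -> 0 < q -> m^-1 + q^-1 = nu^-1 -> nu <= m -> 1 <= nu ->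
  iid_pair X1 X2 Q ->
  (forall x, 0 < p x) -> (forall x, differentiable p x) ->
  measurable_psd_kernel kappa -> kernel_C1 kappa ->
  (forall k x, differentiable (phi k) x) ->
  (N (2 * m) (fun w => norm2 (score p (X1 w))) < +oo)%E ->
  N q (fun w => kernel_err kappa lam phi n (X1 w) (X2 w))
    @[n --> \oo] --> 0%E ->
  N (2 * nu) (fun w => norm2 (grad_err kappa lam phi n (X1 w) (X2 w)))
    @[n --> \oo] --> 0%E ->
  N nu (fun w => trace_err kappa lam phi n (X1 w) (X2 w))
    @[n --> \oo] --> 0%E ->
  N nu (fun w => \sum_(k < n) lam k *
      dotrv (stein p (phi k) (X1 w)) (stein p (phi k) (X2 w))
    - u_KSD p kappa (X1 w) (X2 w)) @[n --> \oo] --> 0%E.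
Proof.
move=> nu0 m0 q0 mq num nu1 X12 p0 dp psdK [dk1 dk2 dk12 _] dphi s_m.
move=> kerr0 gerr0 terr0.
have [mK _] := psdK.
have mphi k := measurable_differentiable (dphi k).
have ms l := measurable_score l p0 dp.
have ms1 l := measurable_comp_RV X1 (ms l).
have ms2 l := measurable_comp_RV X2 (ms l).
have mns := measurable_norm2 ms.
have sE r := iid_Lnorm_law r X12 mns.
have s_nu : (N (2 * nu) (fun w => norm2 (score p (X1 w))) < +oo)%E.
  apply: le_lt_trans s_m; apply: le_Lnorm_exponent.
  - by rewrite mulr_gt0.
  - by rewrite ler_pM2l.
  - exact: measurable_comp_RV mns.
have s2_m := s_m; rewrite sE in s2_m.
have s2_nu := s_nu; rewrite sE in s2_nu.
have mker n := measurable_comp_pair X1 X2 (measurable_kernel_err lam n mK mphi).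
have mgrad n l := measurable_grad_err lam n l mK dk1 dphi.
have mgrad1 n l : measurable_fun setT
    (fun w => grad_err kappa lam phi n (X1 w) (X2 w) 0 l).
  exact: (measurable_comp_pair X1 X2
    (h := fun x y => grad_err kappa lam phi n x y 0 l) (mgrad n l)).
have mgrad2 n l : measurable_fun setT
    (fun w => grad_err kappa lam phi n (X2 w) (X1 w) 0 l).
  exact: (measurable_comp_pair X2 X1
    (h := fun x y => grad_err kappa lam phi n x y 0 l) (mgrad n l)).
have mtrace n := measurable_comp_pair X1 X2
  (measurable_trace_err lam n mK dk2 dk12 dphi).
have gerr0' :
  N (2 * nu) (fun w => norm2 (grad_err kappa lam phi n (X2 w) (X1 w)))
    @[n --> \oo] --> 0%E.
  under eq_fun => n.
    rewrite -(iid_Lnorm_swap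
      (h := fun x y => norm2 (grad_err kappa lam phi n x y)) _ X12); last first.
      by apply: measurable_norm2 => l; exact: mgrad.
    over.
  exact: gerr0.
have mdot1 := measurable_dotrv ms1 ms2.
have T1 := cvg_Lnorm0_dotrvM nu0 m0 q0 mq ms1 ms2 mker s_m s2_m kerr0.
have T2 := cvg_Lnorm0_dotrv nu0 ms1 mgrad2 s_nu gerr0'.
have T3 := cvg_Lnorm0_dotrv nu0 ms2 mgrad1 s2_nu gerr0.
have mT1 n := measurable_funM mdot1 (mker n).
have mT2 n := measurable_dotrv ms1 (mgrad2 n).
have mT3 n := measurable_dotrv ms2 (mgrad1 n).
have T12 := cvg_Lnorm0D nu1 mT1 mT2 T1 T2.
have mT12 n := measurable_funD (mT1 n) (mT2 n).
have T123 := cvg_Lnorm0D nu1 mT12 mT3 T12 T3.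
have mT123 n := measurable_funD (mT12 n) (mT3 n).
under eq_fun => n.
  under eq_Lnorm => w do rewrite (stein_sum_err _ _ _ _ _ _ psdK).
  over.
exact: (cvg_Lnorm0D nu1 mT123 mtrace T123 terr0).
Qed.

End terms.

Unset Implicit Arguments.

(* Sequences indexed by k >= 1 in the source are indexed by k >= 0 here, so
   that alpha_((k'-1)d+l), 1 <= l <= d, becomes alpha (k' * d + l), l < d. *)
Theorem lemma16 (R : realType) (d : nat) (d_gt0 : (0 < d)%N)
  (P Q : probability 'rV[R]_d R)
  (p : 'rV[R]_d -> R)
  (p_density : has_lebesgue_density P p)
  (p_gt0 : forall x, 0 < p x)
  (p_C1 : continuously_differentiable p)
  (kappa : 'rV[R]_d -> 'rV[R]_d -> R)
  (kappa_kernel : measurable_psd_kernel kappa)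
  (kappa_C1 : kernel_C1 kappa)
  (u_integrable : ('E_Q[fun x => u_KSD p kappa x x] < +oo)%E)
  (dO : measure_display) (Omega : measurableType dO)
  (Pr : probability Omega R)
  (X1 X2 : {RV Pr >-> 'rV[R]_d})
  (X_iid : iid_pair X1 X2 Q)
  (nu : R) (nu_gt2 : 2 < nu)
  (kappa_integrable : ('E_Pr[fun w => kappa (X1 w) (X1 w)] < +oo)%E)
  (lam : nat -> R) (phi : nat -> 'rV[R]_d -> R)
  (mercer : weak_mercer X1 X2 Q kappa lam phi)
  (nus : R) (nus_gt : nu < nus)
  (kappa_nus : (Lnorm Pr nus%:E (fun w => (kappa (X1 w) (X2 w))%:E) < +oo)%E)
  (sum_nus : (ereal_sup [set Lnorm Pr nus%:E (fun w =>
      (\sum_(k < K) lam k * phi k (X1 w) * phi k (X2 w))%:E)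
      | K in [set K : nat | (1 <= K)%N]] < +oo)%E)
  (score_bound : let nuss := (nu * (nu + nus) / (nus - nu))%R in
    (Lnorm Pr (2 * nuss)%:E (fun w => (norm2 (score p (X1 w)))%:E) < +oo)%E)
  (phi_bound : (ereal_sup [set Lnorm Pr (2 * nu)%:E (fun w =>
      (phi k (X1 w))%:E) | k in [set: nat]] < +oo)%E)
  (phi_diff : forall k x, differentiable (phi k) x)
  (dphi_bound : (ereal_sup [set Lnorm Pr nu%:E (fun w =>
      (norm2 (grad (phi k) (X1 w)))%:E) | k in [set: nat]] < +oo)%E)
  (grad1_cvg : Lnorm Pr (2 * nu)%:E (fun w =>
      (norm2 (\sum_(k < K) (lam k * phi k (X2 w)) *: grad (phi k) (X1 w)
              - grad1 kappa (X1 w) (X2 w)))%:E)%E @[K --> \oo] --> 0%E)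
  (grad12_cvg : Lnorm Pr nu%:E (fun w =>
      (\sum_(k < K) lam k * dotrv (grad (phi k) (X1 w)) (grad (phi k) (X2 w))
       - \tr (grad12 kappa (X1 w) (X2 w)))%:E)%E @[K --> \oo] --> 0%E)
  (alpha : nat -> R) (psi : nat -> 'rV[R]_d -> R)
  (alphaE : forall (k' : nat) (l : 'I_d), alpha (k' * d + l)%N = lam k')
  (psiE : forall (k' : nat) (l : 'I_d) (x : 'rV[R]_d),
      psi (k' * d + l)%N x
      = partial l (fun y => ln (p y)) x * phi k' x + partial l (phi k') x) :
  Lnorm Pr (Num.min nu 3)%:E (fun w =>
    (\sum_(k < K) alpha k * psi k (X1 w) * psi k (X2 w)
     - u_KSD p kappa (X1 w) (X2 w))%:E)%E @[K --> \oo] --> 0%E.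
Proof.
have nu0 : 0 < nu by lra.
have nu1 : 1 <= nu by lra.
have nus1 : 1 <= nus by lra.
have [mK _] := kappa_kernel.
have [dp _] := p_C1.
have [_ lam_ge0 lam0 _] := mercer.
have mphi k := measurable_differentiable (phi_diff k).
have [nu_nuss q0 q_nus nussE] := hoelder_exponents nu0 nus_gt.
have nuss0 := lt_le_trans nu0 nu_nuss.
have ms l := measurable_score l p_gt0 dp.
have ker0 := cvg_kernel_err mK mphi q0 q_nus nus1 mercer kappa_nus sum_nus.
have main0 := cvg_stein_sum_err nu0 nuss0 q0 nussE nu_nuss nu1 X_iid p_gt0 dp
  kappa_kernel kappa_C1 phi_diff score_bound ker0 grad1_cvg grad12_cvg.
have [Cphi [_ HCphi]] := ge0_ereal_sup_lty_ub (fun=> Lnorm_ge0 _ _ _) phi_bound.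
have [Cdphi [_ HCdphi]] :=
  ge0_ereal_sup_lty_ub (fun=> Lnorm_ge0 _ _ _) dphi_bound.
pose S := fine (Lnorm Pr (2 * nu)%:E (fun w => (norm2 (score p (X1 w)))%:E)).
have HS : (Lnorm Pr (2 * nu)%:E (fun w => (norm2 (score p (X1 w)))%:E)
    <= S%:E)%E.
  rewrite /S fineK// ge0_fin_numE ?Lnorm_ge0//.
  apply: le_lt_trans score_bound.
  apply: le_Lnorm_exponent; [exact: mulr_gt0|by rewrite ler_pM2l|].
  exact: measurable_comp_RV (measurable_norm2 ms).
have rem0 := cvg_Lnorm0_remainder d%:R nu0 X_iid p_gt0 dp phi_diff lam0
  (fun k => Lnorm_stein_dom_le nu1 p_gt0 dp (phi_diff k) HS
     (HCphi k I) (HCdphi k I)).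
(* for K terms the error is at most main q + rem q, where q = K %/ d *)
pose main q w := `|\sum_(k < q) lam k *
    dotrv (stein p (phi k) (X1 w)) (stein p (phi k) (X2 w))
  - u_KSD p kappa (X1 w) (X2 w)|.
pose rem q w := d%:R * lam q *
  (stein_dom p (phi q) (X1 w) * stein_dom p (phi q) (X2 w)).
have mstein k l := measurable_stein l p_gt0 dp (phi_diff k).
have mu := measurable_comp_pair X1 X2
  (measurable_u_KSD p_gt0 dp kappa_kernel kappa_C1).
have mmain q : measurable_fun setT (main q).
  apply: measurableT_comp => //; apply: measurable_funB => //.
  apply: measurable_sum => k; apply: measurable_funM => //.
  by apply: measurable_dotrv => l; exact: measurable_comp_RV (mstein k l).
have mrem q : measurable_fun setT (rem q).
  apply: measurable_funM => //; apply: measurable_funM.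
    exact: measurable_comp_RV (measurable_stein_dom p_gt0 dp (phi_diff q)).
  exact: measurable_comp_RV (measurable_stein_dom p_gt0 dp (phi_diff q)).
have psi_stein k (l : 'I_d) x : psi (k * d + l)%N x = stein p (phi k) x 0 l.
  by rewrite psiE stein_coord.
have mpsi k : measurable_fun setT (psi k).
  have -> : psi k = (fun x => stein p (phi (k %/ d)%N) x 0
      (Ordinal (ltn_pmod k d_gt0))).
    by apply/funext => x; rewrite -psi_stein /= -divn_eq.
  exact: mstein.
have merr K : measurable_fun setT (fun w =>
    \sum_(k < K) alpha k * psi k (X1 w) * psi k (X2 w)
    - u_KSD p kappa (X1 w) (X2 w)).
  apply: measurable_funB => //; apply: measurable_sum => k.
  apply: measurable_funM; last exact: measurable_comp_RV (mpsi k).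
  by apply: measurable_funM => //; exact: measurable_comp_RV (mpsi k).
apply: (cvg_Lnorm0_exponent (p := nu)) => //.
- by rewrite lt_min nu0 ltr0n.
- by rewrite ge_min lexx.
apply: (cvg_Lnorm0_le
  (g_ := fun K w => main (K %/ d)%N w + rem (K %/ d)%N w)) => //.
- by move=> K; exact: measurable_funD.
- move=> K w; have := stein_partial_sum_le kappa (K %/ d) (X1 w) (X2 w)
    (ltn_pmod K d_gt0) lam_ge0 alphaE psi_stein.
  by rewrite -divn_eq.
apply: (cvg_comp (fun K => (K %/ d)%N)
  (fun q => Lnorm Pr nu%:E (fun w => (main q w + rem q w)%:E))).
  exact: cvg_divn.
apply: cvg_Lnorm0D => //.
under eq_fun => q.
  rewrite (Lnorm_abse Pr (fun w => (\sum_(k < q) lam k *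
      dotrv (stein p (phi k) (X1 w)) (stein p (phi k) (X2 w))
    - u_KSD p kappa (X1 w) (X2 w))%:E)).
  over.
exact: main0.
Qed.
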